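(* For $1\le i\le k$, let $\mathbf{v}_i\in\mathbb{Q}(t)^n$, and for every positive integer $t$ at which all the $\mathbf{v}_i$ are defined (in particular for all sufficiently large $t$) let $R(t)\subset\mathbb{R}^n$ be the convex hull of $\mathbf{v}_1(t),\ldots,\mathbf{v}_k(t)$. Then there exists a positive integer $d$ such that for each residue class modulo $d$ there exist an integer $z\ge 0$ and $\mathbf{w}_1,\ldots,\mathbf{w}_z\in\mathbb{Q}[t]^n$ such that for all sufficiently large $t$ in that residue class, the convex hull of the set $R(t)\cap\mathbb{Z}^n$ of lattice points in $R(t)$ has vertices $\mathbf{w}_1(t),\ldots,\mathbf{w}_z(t)$.
   Context: $t$ ranges over positive integers, and $\mathbb{Q}(t)$ is the field of rational functions in $t$. The number $z$ and the vectors $\mathbf{w}_j$ may depend on the residue class, and $z=0$ is allowed (when there are no lattice points). *)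

(* Defs.v *)
From HB Require Import structures.
From mathcomp Require Import all_boot all_order all_algebra fraction generic_quotient.
From mathcomp Require Import all_classical all_reals all_analysis.

Set Implicit Arguments.
Unset Strict Implicit.
Unset Printing Implicit Defensive.

Import Order.TTheory GRing.Theory Num.Theory.

Local Open Scope classical_set_scope.
Local Open Scope ring_scope.
Local Open Scope convex_scope.

Local Notation tofrac := (@FracField.tofrac _).

Section RationalFunctions.
Variable F : fieldType.
Implicit Types (f : {fraction {poly F}}) (a : F).

(* [repr f] need not be in lowest terms, hence the division by the gcd. *)
Definition ratfun_num f : {poly F} :=
  (repr f).1 %/ gcdp (repr f).1 (repr f).2.
Definition ratfun_den f : {poly F} :=
  (repr f).2 %/ gcdp (repr f).1 (repr f).2.

Definition ratfun_defined f a : bool := (ratfun_den f).[a] != 0.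

(* Meaningful only when [ratfun_defined f a]. *)
Definition ratfun_eval f a : F := (ratfun_num f).[a] / (ratfun_den f).[a].

Lemma ratfun_cross f (p q : {poly F}) : q != 0 ->
  f = tofrac p / tofrac q -> p * ratfun_den f = q * ratfun_num f.
Proof.
move=> q0 fE; rewrite /ratfun_num /ratfun_den.
set r := repr f; set g := gcdp _ _.
have d0 : r.2 != 0 by exact: denom_ratioP.
have g0 : g != 0 by rewrite gcdp_eq0 negb_and d0 orbT.
have fr : f = tofrac r.1 / tofrac r.2.
  have rd0 : tofrac r.2 != 0 by rewrite tofrac_eq0.
  apply/(mulIf rd0); rewrite divfK// -[f]reprK -/r.
  unlock FracField.tofrac.
  rewrite -[LHS]FracField.pi_mul; apply/eqP; rewrite FracField.equivf_def.
  rewrite /equivf /FracField.mulf /= !numden_Ratio ?oner_neq0 ?mulr1 ?mulf_neq0//.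
  by rewrite mulrC.
have H : p * r.2 = q * r.1.
  apply/eqP; rewrite -tofrac_eq !tofracM; apply/eqP.
  move: fE; rewrite fr => /eqP; rewrite eqr_div ?tofrac_eq0// => /eqP H.
  by rewrite mulrC -[LHS]mulrC -H mulrC.
apply: (mulIf g0).
by rewrite -!mulrA !divpK ?dvdp_gcdl ?dvdp_gcdr.
Qed.

(* The evaluation may be computed from any representation as a fraction whose
   denominator does not vanish at [a]. *)
Lemma ratfun_evalE f a (p q : {poly F}) : f = tofrac p / tofrac q -> q.[a] != 0 ->
  ratfun_defined f a /\ ratfun_eval f a = p.[a] / q.[a].
Proof.
move=> fE qa; have q0 : q != 0 by apply: contraNneq qa => ->; rewrite horner0.
have H := ratfun_cross q0 fE.
have d0 : (repr f).2 != 0 by exact: denom_ratioP.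
have cop : coprimep (ratfun_num f) (ratfun_den f).
  by rewrite /ratfun_num /ratfun_den coprimep_div_gcd ?d0 ?orbT.
have def : ratfun_defined f a.
  apply/negP => /eqP da.
  have := congr1 (horner^~ a) H; rewrite !hornerM da mulr0 => /esym/eqP.
  rewrite mulf_eq0 (negbTE qa) /= => na.
  have := coprimep_root cop na.
  by rewrite da eqxx.
split=> //; apply/eqP; rewrite /ratfun_eval eqr_div// mulrC -!hornerM.
by rewrite H.
Qed.

End RationalFunctions.

Section ConvexGeometry.
Variables (R : numDomainType) (E : lmodType R).
Implicit Type A : set (convex_lmodType E).

Definition convex_hull A : set (convex_lmodType E) :=
  smallest (@convex_set R E) A.

(* Vertices as extreme points. *)
Definition vertices A : set (convex_lmodType E) :=
  [set x | A x /\ forall (y z : convex_lmodType E) (l : {i01 R}),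
    A y -> A z -> 0 < l%:num < 1 -> x = y <| l |> z -> y = z].

End ConvexGeometry.

Section Families.
Variables (R : realType) (n : nat).

Definition lattice_points : set 'rV[R]_n :=
  [set x | forall i, x 0 i \is a Num.int].

Definition ratvec_defined (v : 'rV[{fraction {poly rat}}]_n) (t : nat) : Prop :=
  forall i, ratfun_defined (v 0 i) t%:R.

Definition ratvec_eval (v : 'rV[{fraction {poly rat}}]_n) (t : nat) : 'rV[R]_n :=
  \row_i ratr (ratfun_eval (v 0 i) t%:R).

Definition polyvec_eval (w : 'rV[{poly rat}]_n) (t : nat) : 'rV[R]_n :=
  \row_i ratr (w 0 i).[t%:R].

Definition polytope_family k (v : 'I_k -> 'rV[{fraction {poly rat}}]_n)
    (t : nat) : set 'rV[R]_n :=
  convex_hull (range (fun i => ratvec_eval (v i) t)).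

End Families.

Arguments lattice_points : clear implicits.
Arguments ratvec_eval R {n} v t.
Arguments polyvec_eval R {n} w t.
Arguments polytope_family R {n k} v t.

(* Main.v *)
(** A lattice point [x] of [R(t)] that is not the midpoint of two other lattice
points of [R(t)] has polynomial coordinates. To see this, write [R(t)] by linear
inequalities with coefficients in [Z[t]], and expand [x] in base [t], which turns
it into a vector [y] of integers of size [O(t)]. Take an ultrafilter over a
sequence of pairs [(t, x)]. If the linear forms in [y] that are affine functions
of [t] along the ultrafilter determine [y], then [x] is a polynomial in [t].
Otherwise a nonzero constant integer vector [u] annihilates all of them, and every
inequality that moving in the direction [u] affects has unbounded slack of larger
order than the change, so [y + u] and [y - u] are both feasible and [x] is a
midpoint. By compactness, finitely many polynomial vectors [w] contain all such
[x] for large [t]. Whether [w(t)] is integral depends on a residue class of [t],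
whereas membership in [R(t)], or in the hull of the other candidates, is decided
by signs of polynomials, hence is eventually constant. *)
From HB Require Import structures.
Require Import Defs.
From mathcomp Require Import all_boot all_order all_algebra fraction.
From mathcomp Require Import all_classical all_reals all_analysis.
From mathcomp Require Import ring lra zify.
Import Order.TTheory GRing.Theory Num.Theory.
Local Open Scope classical_set_scope.
Local Open Scope ring_scope.

(** * Lattice points along an ultrafilter *)

(** A sequence that is bounded along [U] takes finitely many absolute values there. These are
    discarded one by one from the top until the ultrafilter settles on one; it then also settles the
    sign. *)
Lemma ultra_dichotomy {U : set_system nat} {UU : UltraFilter U} (s : nat -> int) :
  (exists c, U [set m | s m = c]) \/ (forall C, U [set m | C < `|s m|]).
Proof.
have [|ns] := pselect (exists c, U [set m | s m = c]); first by left.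
right=> C.
have [h|] := in_ultra_setVsetC [set m | C < `|s m|] UU; first by [].
move=> h; exfalso; apply: ns.
have {}h : U [set m | exists2 i : nat, (i < `|C|.+1)%N & `|s m|%N = i].
  apply: filterS h => m /= /negP h; exists (`|s m|)%N => //; lia.
elim: (`|C|.+1) h => [h|N IH h].
  by have [m /= [i]] := filter_ex h.
have [|hN] := in_ultra_setVsetC [set m | `|s m|%N = N] UU.
  move=> hN; have [hp|hp] := in_ultra_setVsetC [set m | 0 <= s m] UU.
    exists N%:Z; apply: filterS2 hN hp => m /=; lia.
  exists (- N%:Z); apply: filterS2 hN hp => m /= ? /negP; lia.
apply: IH; apply: filterS2 h hN => m /= [i iN si] sN; exists i => //.
move: iN; rewrite ltnS leq_eqVlt => /orP[/eqP iN|//].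
by case: sN; rewrite si.
Qed.

(** Rank alternative over the rationals: with full column rank a left inverse [B] recovers [y] from
    its image; otherwise there is a nonzero kernel vector, made integral by the product [D] of its
    denominators. *)
Lemma left_inverse_or_kernel (I T : finType) (A : I -> T -> int) :
  (exists2 u : T -> int, exists c, u c != 0 & forall i, \sum_c A i c * u c = 0) \/
  (exists B : T -> I -> rat, forall (y : T -> int) c,
     (y c)%:~R = \sum_i B c i * (\sum_c' A i c' * y c')%:~R).
Proof.
pose M := \matrix_(i < #|I|, c < #|T|) ((A (enum_val i) (enum_val c))%:~R : rat).
have [/row_fullP[B BM]|] := boolP (row_full M).
  right; exists (fun c i => B (enum_rank c) (enum_rank i)) => y c.
  pose v := \col_(c < #|T|) ((y (enum_val c))%:~R : rat).
  have := congr1 (fun Y : 'M[rat]_#|T| => (Y *m v) (enum_rank c) 0) BM.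
  rewrite mul1mx -mulmxA [in RHS]mxE enum_rankK mxE => <-.
  rewrite (reindex_onto enum_rank enum_val) /=; last by move=> i _; rewrite enum_valK.
  under eq_bigl do rewrite enum_rankK eqxx.
  apply: eq_bigr => i _; congr (_ * _); rewrite mxE rmorph_sum.
  rewrite (reindex_onto enum_rank enum_val) /=; last by move=> j _; rewrite enum_valK.
  under eq_bigl do rewrite enum_rankK eqxx.
  by apply: eq_bigr => j _; rewrite !mxE !enum_rankK rmorphM.
have -> : row_full M = row_free M^T by rewrite /row_full /row_free mxrank_tr.
rewrite -kermx_eq0 -nz_row_eq0.
set x := nz_row _ => x0; left.
have xM : x *m M^T = 0 by apply/sub_kermxP/nz_row_sub.
pose D := \prod_(c < #|T|) denq (x 0 c).
have D0 : D != 0 by apply/prodf_neq0 => c _; exact: denq_neq0.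
have xE c : x 0 c * D%:~R = (numq (x 0 c * D%:~R))%:~R.
  rewrite numqK // Qint_def /D (bigD1 c) //= rmorphM mulrA /= -numqE -rmorphM.
  by rewrite denq_int.
exists (fun c => numq (x 0 (enum_rank c) * D%:~R)).
  have /rV0Pn[c xc] := x0; exists (enum_val c).
  by rewrite enum_valK -(intr_eq0 rat) -xE mulf_neq0 // intr_eq0.
move=> i; apply: (intr_inj (R := rat)); rewrite rmorph_sum /=.
transitivity ((x *m M^T) 0 (enum_rank i) * D%:~R); last first.
  by rewrite xM mxE mul0r.
rewrite mxE mulr_suml.
rewrite [RHS](reindex_onto enum_rank enum_val) /=; last by move=> j _; rewrite enum_valK.
under [RHS]eq_bigl do rewrite enum_rankK eqxx.
apply: eq_bigr => c _; rewrite rmorphM /= -xE !mxE !enum_rankK.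
by ring.
Qed.

(** For [J > 0] each of the [J] terms of [p] is at most [C * x ^+ J.-1] in absolute value. The
    factor [x] on the left avoids this truncated exponent, so [J = 0] needs no separate case. *)
Lemma horner_bound (p : {poly int}) J (C x : int) : (size p <= J)%N -> 1 <= x ->
  (forall i, `|p`_i| <= C) -> x * `|p.[x]| <= J%:Z * C * x ^+ J.
Proof.
move=> sp x1 pC; rewrite (horner_coef_wide _ sp).
have x0 : 0 <= x by lia.
rewrite -mulrA -[J in J%:Z]card_ord -natz mulr_natl -sumr_const.
apply: (@le_trans _ _ (\sum_(i < J) x * (C * x ^+ i))).
  rewrite -mulr_sumr ler_wpM2l //; apply: (le_trans (ler_norm_sum _ _ _)).
  apply: ler_sum => i _; rewrite normrM normrX (ger0_norm x0).
  by rewrite ler_wpM2r ?exprn_ge0.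
apply: ler_sum => i _; rewrite mulrCA -exprS.
have C0 : 0 <= C by apply: le_trans (pC 0%N).
by rewrite ler_wpM2l // ler_weXn2l.
Qed.

Lemma drop_polyS (R : nzRingType) j (p : {poly R}) :
  drop_poly j p = (p`_j)%:P + drop_poly j.+1 p * 'X.
Proof.
by apply/polyP => -[|i]; rewrite !coefE //= ?addr0 // add0r addSnnS.
Qed.

(* Write [G = b i + \sum_c y m c *: A i c] and let [s j] be the value at [t] of
   [G] shifted down by [j] degrees, so that [s j = G`_j + s j.+1 * t]. Along the
   ultrafilter each [s j] is either constant or unbounded. Let [J i] be minimal
   such that [s j] is constant for all [j >= J i]; for these [j] the linear form
   [G`_j] in [y] is an affine function of [t]. Either these forms determine [y],
   or a constant [u] annihilates them all, and then the unbounded term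
   [s (J i).-1 * t ^ (J i).-1] dominates the variation of the constraint in the
   direction [u]. *)
Lemma lattice_dichotomy (I T : finType) (A : I -> T -> {poly int})
    (b : I -> {poly int}) (U : set_system nat) {UU : UltraFilter U}
    (t : nat -> int) (y : nat -> T -> int) :
  (forall N, U [set m | N < t m]) ->
  U [set m | forall c, `|y m c| <= t m] ->
  U [set m | forall i, 0 <= (b i + \sum_c y m c *: A i c).[t m]] ->
  (exists w : T -> {poly rat},
     U [set m | forall c, (w c).[(t m)%:~R] = (y m c)%:~R]) \/
  (exists2 u : T -> int, exists c, u c != 0 &
     U [set m | forall i,
       `|(\sum_c u c *: A i c).[t m]| <= (b i + \sum_c y m c *: A i c).[t m]]).
Proof.
move=> tU yU GU.
pose G m i := b i + \sum_c y m c *: A i c.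
pose E := (\max_i (maxn (size (b i)) (\max_c size (A i c))))%N.
have szb i : (size (b i) <= E)%N.
  by apply: leq_trans (leq_bigmax i); exact: leq_maxl.
have szA i c : (size (A i c) <= E)%N.
  apply: leq_trans (leq_bigmax i); apply: leq_trans (leq_maxr _ _).
  by apply: leq_trans (leq_bigmax c).
have coefG m i j : (G m i)`_j = (b i)`_j + \sum_c y m c * (A i c)`_j.
  by rewrite coefD coef_sum; under eq_bigr do rewrite coefZ.
have coefE i c j : (E <= j)%N -> (A i c)`_j = 0.
  by move=> Ej; rewrite nth_default // (leq_trans _ Ej).
have szG m i : (size (G m i) <= E)%N.
  apply/leq_sizeP => j Ej; rewrite coefG nth_default ?(leq_trans _ Ej) // add0r.
  by rewrite big1 // => c _; rewrite coefE // mulr0.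
pose s j i m := (drop_poly j (G m i)).[t m].
have sS j i m : s j i m = (G m i)`_j + s j.+1 i m * t m.
  by rewrite /s drop_polyS hornerD hornerC hornerMX.
have sE i m j : (E <= j)%N -> s j i m = 0.
  by move=> Ej; rewrite /s drop_poly_eq0 ?horner0 // (leq_trans (szG _ _)).
pose fin j i := exists c, U [set m | s j i m = c].
have [J HJ] : exists J : I -> nat, forall i, [/\ (J i <= E)%N,
    forall j, (J i <= j)%N -> fin j i & forall j, J i = j.+1 -> ~ fin j i].
  suff /choice[J HJ] : forall i, exists J : nat, [/\ (J <= E)%N,
    forall j, (J <= j)%N -> fin j i & forall j, J = j.+1 -> ~ fin j i] by exists J.
  move=> i; pose P k := `[< forall j, (k <= j)%N -> fin j i >].
  have PE : P E.
    by apply/asboolP => j Ej; exists 0; apply: filterE => m /=; exact: sE.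
  have := ex_minnP (ex_intro P E PE); case=> J /asboolP JP Jmin; exists J; split => //.
    exact: Jmin.
  move=> j Jj fj; have : (J <= j)%N; last by rewrite Jj ltnn.
  apply: Jmin; apply/asboolP => k; rewrite leq_eqVlt => /orP[/eqP <-//|jk].
  by apply: JP; rewrite Jj.
have [sg Hsg] : exists sg : nat * I -> int, forall p, (J p.2 <= p.1)%N ->
    U [set m | s p.1 p.2 m = sg p].
  suff /choice[sg Hsg] : forall p : nat * I, exists c, (J p.2 <= p.1)%N ->
    U [set m | s p.1 p.2 m = c] by exists sg.
  move=> -[j i] /=; have [Jj|_] := boolP (J i <= j)%N; last by exists 0.
  by have [_ /(_ _ Jj)[c cU] _] := HJ i; exists c.
(* The indices run up to [E] inclusive because the linear form of degree [j < E] is recovered from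
   both [s j] and [s j.+1]. *)
have sgU : U [set m | forall i (j : 'I_E.+1), (J i <= j)%N -> s j i m = sg (val j, i)].
  apply: filter_forall => i; apply: filter_forall => j.
  have [Jj|_] := boolP (J i <= j)%N; last exact: filterE.
  by apply: filterS (Hsg (val j, i) Jj) => m /= -> _.
(* One row per constraint [i] and degree [j]: the linear part of the coefficient of [G] if
   [J i <= j], and a zero row otherwise. *)
have [[u u0 uA]|[B HB]] := left_inverse_or_kernel _ _
  (fun (p : I * 'I_E) c => if (J p.1 <= p.2)%N then (A p.1 c)`_p.2 else 0); last first.
  (* By [sS], the linear form of degree [j] equals [s j] minus the coefficient of [b] minus
     [s j.+1 * t], with [s j] and [s j.+1] now constants. *)
  left; exists (fun c => \sum_p B c p *: (if (J p.1 <= p.2)%N then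
     (sg (val p.2, p.1) - (b p.1)`_p.2)%:~R%:P - (sg (p.2.+1, p.1))%:~R *: 'X else 0)).
  apply: filterS sgU => m /= sgm c; rewrite HB horner_sum.
  apply: eq_bigr => -[i j] _ /=; rewrite hornerZ; congr (_ * _).
  case: ifPn => Jj; last by rewrite horner0 big1 // => c' _; rewrite mul0r.
  rewrite hornerD hornerN hornerZ hornerC hornerX -rmorphM -rmorphB /=; congr _%:~R.
  have := sgm i (inord j); rewrite inordK ?leqW // => <- //.
  have := sgm i (inord j.+1); rewrite inordK ?ltnS // => <-; last exact: leqW.
  rewrite sS coefG; under [in RHS]eq_bigr do rewrite mulrC.
  by ring.
right; exists u => //; pose H i := \sum_c u c *: A i c.
have coefH i j : (J i <= j)%N -> (H i)`_j = 0.
  move=> Jj; rewrite coef_sum; have [jE|Ej] := ltnP j E; last first.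
    by rewrite big1 // => c _; rewrite coefZ coefE // mulr0.
  rewrite -[RHS](uA (i, Ordinal jE)) /= Jj.
  by apply: eq_bigr => c _; rewrite coefZ mulrC.
pose K i := \sum_(j < E) (`|(b i)`_j| + \sum_c `|(A i c)`_j|).
pose L i := \sum_(j < E) `|(H i)`_j|.
have HL i j : `|(H i)`_j| <= L i.
  have [jE|Ej] := ltnP j E.
    rewrite /L (bigD1 (Ordinal jE)) //= lerDl; apply: sumr_ge0 => *; exact: normr_ge0.
  rewrite coefH ?normr0; first by apply: sumr_ge0 => *; exact: normr_ge0.
  by apply: leq_trans Ej; have [] := HJ i.
apply: filter_forall => i; have [JE Jfin Jnfin] := HJ i.
case JJ: (J i) => [|j].
  apply: filterS GU => m /= /(_ i); apply: le_trans.
  rewrite -/(H i) (_ : H i = 0) ?horner0 ?normr0 //.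
  by apply/polyP => j; rewrite coefH ?coef0 ?JJ.
(* The threshold beats all other terms: the part of [G] below degree [j] has coefficients at most
   [K i * t], hence is at most [j * K i * t ^+ j], and the variation [H], of degree at most [j], is
   at most [j.+1 * L i * t ^+ j]. *)
have [/(Jnfin _ JJ) //|/(_ (j%:Z * K i + j.+1%:Z * L i)) sU] := ultra_dichotomy (s j i).
apply: filterS (filterI (filterI (tU 0) yU) (filterI (GU) sU)).
move=> m /= [[t0 ym] [/(_ i) Gm sm]].
have GE : (G m i).[t m] = (take_poly j (G m i)).[t m] + s j i m * t m ^+ j.
  by rewrite -[in LHS](poly_take_drop j (G m i)) hornerD hornerM hornerXn.
have b1 : t m * `|(take_poly j (G m i)).[t m]| <= j%:Z * (K i * t m) * t m ^+ j.
  apply: horner_bound; [exact: size_take_poly|lia|move=> k].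
  have t1 : 1 <= t m by lia.
  rewrite coef_take_poly; case: ltnP => kj; last first.
    rewrite normr0 mulr_ge0 ?(ltW t0) //; apply: sumr_ge0 => k' _.
    by rewrite addr_ge0 ?sumr_ge0.
  have kE : (k < E)%N by rewrite (leq_trans kj) // (leq_trans _ JE) // JJ.
  rewrite /K (bigD1 (Ordinal kE)) //= mulrDl ler_wpDr //.
    rewrite mulr_ge0 ?(ltW t0) //; apply: sumr_ge0 => k' _.
    by rewrite addr_ge0 ?sumr_ge0.
  rewrite coefG mulrDl; apply: (le_trans (ler_normD _ _)); apply: lerD.
    by rewrite -[leLHS]mulr1 ler_wpM2l.
  apply: (le_trans (ler_norm_sum _ _ _)); rewrite mulr_suml; apply: ler_sum => c _.
  by rewrite normrM mulrC ler_wpM2l.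
have b2 : t m * `|(H i).[t m]| <= j.+1%:Z * L i * t m ^+ j.+1.
  apply: horner_bound; [|lia|exact: HL].
  by apply/leq_sizeP => k jk; rewrite coefH // JJ.
have tj : 0 < t m ^+ j by rewrite exprn_gt0.
have {b1} b1 : `|(take_poly j (G m i)).[t m]| <= j%:Z * K i * t m ^+ j.
  by rewrite -(ler_pM2l t0); apply: le_trans b1 _; rewrite -!mulrA; lia.
have {b2} b2 : `|(H i).[t m]| <= j.+1%:Z * L i * t m ^+ j.
  by rewrite -(ler_pM2l t0); apply: le_trans b2 _; rewrite exprS -!mulrA; lia.
rewrite -/(H i) -/(G m i) in Gm *.
(* A negative [s] of this size would make the constraint itself negative. *)
have s0 : 0 <= s j i m.
  rewrite leNgt; apply/negP => sn.
  have : s j i m * t m ^+ j < - (j%:Z * K i * t m ^+ j).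
    rewrite -mulNr ltr_pM2r //.
    have : 0 <= j.+1%:Z * L i by rewrite mulr_ge0 ?sumr_ge0.
    by move: sm; rewrite ltr0_norm //; lia.
  by lia.
move: sm; rewrite (ger0_norm s0) -(ltr_pM2r tj) mulrDl GE; lia.
Qed.

(** * Growth of polynomials and parametric half-space descriptions *)

Definition peval (R : realType) (t : nat) : {poly rat} -> R :=
  ratr \o horner_eval t%:R.
HB.instance Definition _ R t :=
  GRing.RMorphism.copy (peval R t) (ratr \o horner_eval t%:R).

Lemma pevalE (R : realType) t p : peval R t p = ratr p.[t%:R]. Proof. by []. Qed.
Lemma pevalX (R : realType) t : peval R t 'X = t%:R.
Proof. by rewrite pevalE hornerX ratr_nat. Qed.
Lemma pevalC (R : realType) t c : peval R t c%:P = ratr c.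
Proof. by rewrite pevalE hornerC. Qed.

Lemma near_seq (T : eqType) (s : seq T) (P : T -> nat -> Prop) :
  (forall a, a \in s -> \forall t \near \oo, P a t) ->
  \forall t \near \oo, forall a, a \in s -> P a t.
Proof.
elim: s => [|a s IH] H; first by apply: filterE => t a; rewrite in_nil.
have Ha := H a (mem_head _ _).
have Hs : \forall t \near \oo, forall a, a \in s -> P a t.
  by apply: IH => b bs; apply: H; rewrite inE bs orbT.
apply: filterS2 Ha Hs => t Pa Ps b.
by rewrite inE => /orP[/eqP ->|]; [exact: Pa|exact: Ps].
Qed.

Section PolyGrowth.
Variable R : realType.

Lemma near_natr_ge (x : R) : \forall t \near \oo, x <= t%:R.
Proof. exact: nbhs_infty_ger. Qed.

(** Induction on Horner form: if [p] stays at distance [e] from zero on one side, then [p * 'X + c]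
    is beyond 1 on the same side once [e * t >= 1 + |c|]. A bound away from zero, rather than a mere
    sign, carries the induction and later controls denominators. *)
Lemma peval_lower_bound p : p != 0 -> exists2 e : R, 0 < e &
  (\forall t \near \oo, e <= peval R t p) \/
  (\forall t \near \oo, peval R t p <= - e).
Proof.
elim/poly_ind: p => [|p c IH]; first by rewrite eqxx.
have [-> |p0 _] := eqVneq p 0.
  rewrite mul0r add0r polyC_eq0 => c0; exists `|ratr c|.
    by rewrite normr_gt0 fmorph_eq0.
  case: (lerP 0 (ratr c : R)) => [c0'|/ltW c0']; [left|right]; apply: filterE => t.
    by rewrite pevalC ger0_norm.
  by rewrite pevalC ler0_norm // opprK.
have [e e0 H] := IH p0; exists 1 => //.
have HN := near_natr_ge (e^-1 * (1 + `|ratr c|)).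
have key t : e^-1 * (1 + `|ratr c|) <= t%:R :> R -> 1 + `|ratr c| <= e * t%:R.
  by rewrite mulrC ler_pdivrMr // mulrC.
case: H => H; [left|right]; apply: filterS2 H HN => t Hp /key Ht;
  rewrite rmorphD rmorphM /= pevalX pevalC.
  have : e * t%:R <= peval R t p * t%:R by rewrite ler_wpM2r.
  have := ler_norm (- (ratr c : R)); rewrite normrN; lra.
have : peval R t p * t%:R <= - e * t%:R by rewrite ler_wpM2r.
have := ler_norm (ratr c : R); lra.
Qed.

Lemma peval_upper_bound p : exists D : nat,
  \forall t \near \oo, `|peval R t p| <= t%:R ^+ D.
Proof.
elim/poly_ind: p => [|p c [D IH]].
  by exists 0%N; apply: filterE => t; rewrite rmorph0 normr0 expr0.
(* One power pays for the factor [t], the other for the sum, as [2 * t ^+ D.+1 <= t ^+ D.+2] when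
   [t >= 2]. *)
exists D.+2; near=> t.
rewrite rmorphD rmorphM /= pevalX pevalC.
have t2 : 2 <= t%:R :> R by near: t; exact: near_natr_ge.
have tc : `|ratr c| <= t%:R :> R by near: t; exact: near_natr_ge.
have tp : `|peval R t p| <= t%:R ^+ D by near: t.
have tD : 1 <= t%:R ^+ D :> R by rewrite exprn_ege1 //; lra.
apply: le_trans (ler_normD _ _) _; rewrite normrM (ger0_norm (ler0n _ _)).
have h1 : `|peval R t p| * t%:R <= t%:R ^+ D * t%:R by rewrite ler_wpM2r.
have h2 : t%:R <= t%:R ^+ D * t%:R :> R by rewrite ler_peMl //; lra.
have h3 : 2 * (t%:R ^+ D * t%:R) <= t%:R * (t%:R ^+ D * t%:R) :> R.
  by rewrite ler_wpM2r //; lra.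
by rewrite !exprS; lra.
Unshelve. all: by end_near. Qed.

Lemma peval_sign p : [\/ p = 0, \forall t \near \oo, 0 < peval R t p
  | \forall t \near \oo, peval R t p < 0].
Proof.
have [->|/peval_lower_bound[e e0 [H|H]]] := eqVneq p 0; first by constructor 1.
  by constructor 2; apply: filterS H => t; exact: lt_le_trans.
by constructor 3; apply: filterS H => t /le_lt_trans; apply; rewrite oppr_lt0.
Qed.

Lemma peval_ge0_decided p : (\forall t \near \oo, 0 <= peval R t p) \/
  (\forall t \near \oo, peval R t p < 0).
Proof.
have [->|H|H] := peval_sign p; [left|left|by right].
  by apply: filterE => t; rewrite rmorph0.
by apply: filterS H => t /ltW.
Qed.

Lemma peval_neq0 p : p != 0 -> \forall t \near \oo, peval R t p != 0.
Proof.
have [-> /eqP //|H _|H _] := peval_sign p; apply: filterS H => t.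
  by move/lt0r_neq0.
by move/ltr0_neq0.
Qed.

End PolyGrowth.

(** * Linear forms and finitely generated cones *)

Definition dotv {K : comNzRingType} {N} (a x : 'rV[K]_N) : K := (a *m x^T) 0 0.

Section Dotv.
Context {K : comNzRingType} {N : nat}.
Implicit Types a b x y : 'rV[K]_N.

Lemma dotvE a x : dotv a x = \sum_i a 0 i * x 0 i.
Proof. by rewrite /dotv mxE; apply: eq_bigr => i _; rewrite mxE. Qed.
Lemma dotvDl a b x : dotv (a + b) x = dotv a x + dotv b x.
Proof. by rewrite /dotv mulmxDl mxE. Qed.
Lemma dotvDr a x y : dotv a (x + y) = dotv a x + dotv a y.
Proof. by rewrite /dotv linearD mulmxDr mxE. Qed.
Lemma dotvZl c a x : dotv (c *: a) x = c * dotv a x.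
Proof. by rewrite /dotv -scalemxAl mxE. Qed.
Lemma dotvZr c a x : dotv a (c *: x) = c * dotv a x.
Proof. by rewrite /dotv linearZ -scalemxAr mxE. Qed.
Lemma dotvNl a x : dotv (- a) x = - dotv a x.
Proof. by rewrite -scaleN1r dotvZl mulN1r. Qed.
Lemma dotvNr a x : dotv a (- x) = - dotv a x.
Proof. by rewrite -scaleN1r dotvZr mulN1r. Qed.
Lemma dotvBl a b x : dotv (a - b) x = dotv a x - dotv b x.
Proof. by rewrite dotvDl dotvNl. Qed.
Lemma dotvBr a x y : dotv a (x - y) = dotv a x - dotv a y.
Proof. by rewrite dotvDr dotvNr. Qed.
Lemma dotv_delta i x : dotv (delta_mx 0 i) x = x 0 i.
Proof.
by rewrite /dotv -rowE !mxE.
Qed.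
End Dotv.

Definition rveval (R : realType) {N} t (g : 'rV[{poly rat}]_N) : 'rV[R]_N :=
  map_mx (peval R t) g.

Lemma peval_dotv (R : realType) N t (a g : 'rV[{poly rat}]_N) :
  peval R t (dotv a g) = dotv (rveval R t a) (rveval R t g).
Proof. by rewrite /dotv /rveval map_trmx -map_mxM [RHS]mxE. Qed.

(** The recursive form gives each generator one nonnegative coefficient, which can be eliminated
    separately. *)
Fixpoint in_cone {K : numDomainType} {N} (L : seq 'rV[K]_N) (x : 'rV[K]_N) : Prop :=
  if L is g :: L' then exists2 c, 0 <= c & in_cone L' (x - c *: g) else x = 0.

Lemma argmax_seq (T : eqType) (K : realDomainType) (f : T -> K) (x0 : T) (s : seq T) :
  exists2 x, x \in x0 :: s & forall y, y \in x0 :: s -> f y <= f x.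
Proof.
elim: s => [|y s [x xs xmax]].
  by exists x0; rewrite ?mem_head // => x; rewrite mem_seq1 => /eqP ->.
have [xy|/ltW yx] := leP (f x) (f y).
  exists y; first by rewrite !inE eqxx orbT.
  move=> z; rewrite !inE => /or3P[/eqP ->|/eqP ->//|zs].
    by apply: le_trans xy; apply: xmax; rewrite mem_head.
  by apply: le_trans xy; apply: xmax; rewrite inE zs orbT.
exists x; first by move: xs; rewrite !inE => /orP[] ->; rewrite ?orbT.
move=> z; rewrite !inE => /or3P[/eqP ->|/eqP ->//|zs].
  by apply: xmax; rewrite mem_head.
by apply: xmax; rewrite inE zs orbT.
Qed.

(* Double description: adding a generator [g] to a cone given by inequalities
   amounts to eliminating one nonnegative variable. *)
Lemma cone_halfspaces (R : realType) N (L : seq 'rV[{poly rat}]_N) :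
  exists s : seq 'rV[{poly rat}]_N, \forall t \near \oo, forall x : 'rV[R]_N,
    in_cone (map (rveval R t) L) x <->
    forall a, a \in s -> 0 <= dotv (rveval R t a) x.
Proof.
elim: L => [|g L [s IH]].
  (* The zero cone is cut out by the coordinates and their negatives. *)
  exists ([seq delta_mx 0 i | i <- enum 'I_N] ++
          [seq - delta_mx 0 i | i <- enum 'I_N]).
  apply: filterE => t x; split => [-> a _|H].
    by rewrite /dotv linear0 mulmx0 mxE.
  apply/rowP => i; apply/eqP; rewrite mxE eq_le.
  have Hd (b : {poly rat}) : rveval R t (b *: delta_mx 0 i) = peval R t b *: delta_mx 0 i.
    apply/rowP => j; rewrite !mxE rmorphM; congr (_ * _); exact: rmorph_nat.
  have := H (1 *: delta_mx 0 i); rewrite Hd rmorph1 !scale1r dotv_delta => ->.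
    have := H (-1 *: delta_mx 0 i); rewrite Hd rmorphN rmorph1 !scaleN1r dotvNl.
    rewrite dotv_delta oppr_ge0 => -> //.
    by rewrite mem_cat [X in _ || X]map_f ?orbT // mem_enum.
  by rewrite mem_cat map_f // mem_enum.
(* The sign of each constraint at [g] is eventually constant, so a single elimination serves all
   large [t]. *)
pose pos a := `[< \forall t \near \oo, 0 < peval R t (dotv a g) >].
pose neg a := `[< \forall t \near \oo, peval R t (dotv a g) < 0 >].
(* Fourier-Motzkin elimination: constraints nonnegative at [g] are kept, and each positive one is
   combined with each negative one so that the combination vanishes at [g]. *)
exists ([seq a <- s | ~~ neg a] ++
  [seq dotv a g *: b - dotv b g *: a | a <- [seq a <- s | pos a], b <- [seq b <- s | neg b]]).
have sgn : \forall t \near \oo, forall a, a \in s ->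
    (pos a -> 0 < peval R t (dotv a g)) /\ (neg a -> peval R t (dotv a g) < 0) /\
    (~~ pos a -> ~~ neg a -> peval R t (dotv a g) = 0).
  apply: near_seq => a _.
  have [H|H|H] := peval_sign R (dotv a g).
  - rewrite H; have p0 : ~~ pos a.
      by apply/asboolP; rewrite H => /filter_ex[t]; rewrite rmorph0 ltxx.
    have n0 : ~~ neg a.
      by apply/asboolP; rewrite H => /filter_ex[t]; rewrite rmorph0 ltxx.
    by apply: filterE => t; rewrite rmorph0 (negbTE p0) (negbTE n0).
  - have pa : pos a by apply/asboolP.
    have na : ~~ neg a.
      apply/asboolP => H'; have [t [h1 h2]] := filter_ex (filterI H H').
      by have := lt_trans h1 h2; rewrite ltxx.
    by apply: filterS H => t Ht; rewrite pa (negbTE na).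
  - have pa : neg a by apply/asboolP.
    have na : ~~ pos a.
      apply/asboolP => H'; have [t [h1 h2]] := filter_ex (filterI H' H).
      by have := lt_trans h1 h2; rewrite ltxx.
    by apply: filterS H => t Ht; rewrite pa (negbTE na).
apply: filterS2 IH sgn => t IH sgn x /=.
have dE a : peval R t (dotv a g) = dotv (rveval R t a) (rveval R t g) by exact: peval_dotv.
have combE a b : dotv (rveval R t (dotv a g *: b - dotv b g *: a)) x =
    peval R t (dotv a g) * dotv (rveval R t b) x -
    peval R t (dotv b g) * dotv (rveval R t a) x.
  rewrite -!dotvZl -dotvBl; congr dotv.
  by apply/rowP => i; rewrite !mxE rmorphB !rmorphM.
split=> [[c c0 /IH Hc] a|H].
  have {}Hc b : b \in s -> c * peval R t (dotv b g) <= dotv (rveval R t b) x.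
    by move=> /Hc; rewrite dotvBr dotvZr -dE subr_ge0.
  rewrite mem_cat => /orP[|/allpairsP[[a' b] /= [+ + ->]]].
    rewrite mem_filter => /andP[na sa]; apply: le_trans (Hc a sa); apply: mulr_ge0 => //.
    have [pa [_ za]] := sgn a sa.
    by have [/pa/ltW //|/za -> //] := boolP (pos a).
  rewrite !mem_filter => /andP[pa sa] /andP[nb sb].
  have {}pa := (sgn _ sa).1 pa; have {}nb := (sgn _ sb).2.1 nb.
  rewrite combE.
  have h1 := ler_wpM2l (ltW pa) (Hc b sb).
  have h2 := ler_wnM2l (ltW nb) (Hc a' sa).
  rewrite subr_ge0; apply: le_trans h2 _; apply: le_trans h1.
  by rewrite mulrCA [in leRHS]mulrCA (mulrC (peval _ _ (dotv b g))).
(* A constraint [b] negative at [g] bounds the coefficient of [g] from below by [q b]. The least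
   admissible value is taken, with 0 in the list to ensure nonnegativity. *)
pose q b := dotv (rveval R t b) x / peval R t (dotv b g).
have [c cs cmax] := argmax_seq _ _ id (0 : R) [seq q b | b <- [seq b <- s | neg b]].
have c0 : 0 <= c by apply: cmax; rewrite mem_head.
exists c => //; apply/IH => a sa; rewrite dotvBr dotvZr -dE subr_ge0.
have [na|na] := boolP (neg a).
  rewrite -ler_ndivrMr; last exact: (sgn a sa).2.1.
  by apply: (cmax (q a)); rewrite inE map_f ?orbT // mem_filter na.
have ax : 0 <= dotv (rveval R t a) x.
  by apply: H; rewrite mem_cat mem_filter na sa.
have [pa|pa] := boolP (pos a); last by rewrite (sgn a sa).2.2 // mulr0.
move: cs; rewrite inE => /orP[/eqP ->|/mapP[b +->]]; first by rewrite mul0r.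
rewrite mem_filter => /andP[nb sb].
have := H (dotv a g *: b - dotv b g *: a); rewrite combE mem_cat.
have -> : dotv a g *: b - dotv b g *: a \in
  [seq dotv a g *: b - dotv b g *: a | a <- [seq a <- s | pos a], b <- [seq b <- s | neg b]].
  by apply/allpairsP; exists (a, b); rewrite !mem_filter pa sa nb sb.
rewrite orbT subr_ge0 => /(_ isT) h; have bneg := (sgn b sb).2.1 nb.
by rewrite /q mulrAC ler_ndivrMr // mulrC [leRHS]mulrC.
Qed.

(** * Convex hulls and extreme points *)

Section ConvexHull.
Context {R : realType} {n : nat}.
Implicit Types (A C : set 'rV[R]_n) (x y z : 'rV[R]_n).

Definition comb_closed C := forall x y (a b : R), C x -> C y -> 0 <= a -> 0 <= b ->
  a + b = 1 -> C (a *: x + b *: y).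

Lemma comb_closed_convex C : comb_closed C -> @convex_set R 'rV[R]_n C.
Proof.
move=> CC x y l /set_mem Cx /set_mem Cy; apply/mem_set.
by apply: (CC x y l%:num (1 - l%:num)) => //; rewrite ?subr_ge0 // addrC subrK.
Qed.

Lemma sub_convex_hull A : A `<=` convex_hull (A : set (convex_lmodType 'rV[R]_n)).
Proof. exact: sub_gen_smallest. Qed.

Lemma convex_hull_sub A C : comb_closed C -> A `<=` C ->
  convex_hull (A : set (convex_lmodType 'rV[R]_n)) `<=` C.
Proof. by move=> /comb_closed_convex CC AC; apply: smallest_sub. Qed.

Lemma convex_hull_comb A : comb_closed (convex_hull (A : set (convex_lmodType 'rV[R]_n))).
Proof.
move=> x y a b hx hy a0 b0 ab C [CC AC].
have a1 : a <= 1 by rewrite -ab lerDl.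
have -> : b = 1 - a by rewrite -ab addrC addKr.
have := CC x y (Itv01 a0 a1) (mem_set (hx C (conj CC AC))) (mem_set (hy C (conj CC AC))).
by move/set_mem.
Qed.

Lemma convex_hull_mono A C :
  A `<=` convex_hull (C : set (convex_lmodType 'rV[R]_n)) ->
  convex_hull (A : set (convex_lmodType 'rV[R]_n)) `<=`
  convex_hull (C : set (convex_lmodType 'rV[R]_n)).
Proof. by move=> AC; apply: convex_hull_sub => //; exact: convex_hull_comb. Qed.

(** A zero weight makes [x] an endpoint; with both weights positive, extremality forces [y = z]. *)
Lemma vertex_comb A x y z (a b : R) :
  vertices (A : set (convex_lmodType 'rV[R]_n)) x -> A y -> A z ->
  0 <= a -> 0 <= b -> a + b = 1 -> x = a *: y + b *: z -> x = y \/ x = z.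
Proof.
move=> [Ax xv] Ay Az a0 b0 ab xE.
have [aE|an] := eqVneq a 0.
  by right; move: ab xE; rewrite aE scale0r !add0r => ->; rewrite scale1r.
have [bE|bn] := eqVneq b 0.
  by left; move: ab xE; rewrite bE scale0r !addr0 => ->; rewrite scale1r.
have a1 : a <= 1 by rewrite -ab lerDl.
have bE : b = 1 - a by rewrite -ab addrC addKr.
have yz : y = z.
  apply: (xv y z (Itv01 a0 a1)) => //=.
    by rewrite lt_def an a0 /= -ab ltrDl lt_def bn.
  by rewrite xE bE.
by left; rewrite xE yz -scalerDl ab scale1r.
Qed.

(** A convex set stays convex when an extreme point is removed. An extreme point outside [A] could
    thus be removed from the hull, against minimality. *)
Lemma vertices_convex_hull_sub A :
  vertices (convex_hull (A : set (convex_lmodType 'rV[R]_n))) `<=` A.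
Proof.
move=> x xv; apply: contrapT => nAx.
pose C := convex_hull (A : set (convex_lmodType 'rV[R]_n)) `\ x.
have : C x.
  suff : convex_hull (A : set (convex_lmodType 'rV[R]_n)) `<=` C by apply; case: xv.
  apply: convex_hull_sub => [y z a b [hy yx] [hz zx] a0 b0 ab|y Ay].
    split; first exact: convex_hull_comb.
    move=> /= /esym xE.
    by have [] := vertex_comb _ _ _ _ _ _ xv hy hz a0 b0 ab xE => xE'; [apply: yx|apply: zx].
  by split; [exact: sub_convex_hull|move=> /= yx; apply: nAx; rewrite -yx].
by case=> _ /(_ erefl).
Qed.

End ConvexHull.

(** * Homogenization: hulls as slices of cones *)

Lemma in_coneD (K : numDomainType) N (L : seq 'rV[K]_N) x y :
  in_cone L x -> in_cone L y -> in_cone L (x + y).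
Proof.
elim: L x y => [|g L IH] x y /=; first by move=> -> ->; rewrite addr0.
move=> [c c0 xc] [d d0 yd]; exists (c + d); first exact: addr_ge0.
by rewrite scalerDl opprD addrACA; apply: IH.
Qed.

Lemma in_coneZ (K : numDomainType) N (L : seq 'rV[K]_N) a x :
  0 <= a -> in_cone L x -> in_cone L (a *: x).
Proof.
move=> a0; elim: L x => [|g L IH] x /=; first by move=> ->; rewrite scaler0.
move=> [c c0 /IH xc]; exists (a * c); first exact: mulr_ge0.
by rewrite -scalerA -scalerBr.
Qed.

Lemma in_cone_mem (K : numDomainType) N (L : seq 'rV[K]_N) g : g \in L -> in_cone L g.
Proof.
elim: L => [//|h L IH]; rewrite inE => /orP[/eqP ->|/IH gL] /=.
  exists 1 => //; rewrite scale1r subrr.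
  elim: L {IH} => //= f L; exists 0 => //; by rewrite scale0r subr0.
by exists 0 => //; rewrite scale0r subr0.
Qed.

(* The point of the affine chart [x_0 = 1] on the ray through [g]. *)
Definition dehomog {K : fieldType} {n} (g : 'rV[K]_(1 + n)) : 'rV[K]_n :=
  (lsubmx g 0 0)^-1 *: rsubmx g.

Lemma dehomog_row_mx1 (K : fieldType) n (x : 'rV[K]_n) : dehomog (row_mx 1 x) = x.
Proof. by rewrite /dehomog row_mxKl row_mxKr mxE eqxx invr1 scale1r. Qed.

Lemma row_mx1_dehomog (K : fieldType) n (g : 'rV[K]_(1 + n)) :
  lsubmx g 0 0 != 0 -> row_mx 1 (dehomog g) = (lsubmx g 0 0)^-1 *: g.
Proof.
move=> g0; rewrite -[X in _ = _ *: X](hsubmxK g) scale_row_mx; congr row_mx.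
by apply/rowP => i; rewrite !ord1 [RHS]mxE mulVf // mxE.
Qed.

Lemma row_mx1_comb (K : pzRingType) n (y z : 'rV[K]_n) (a b : K) : a + b = 1 ->
  row_mx 1 (a *: y + b *: z) = a *: row_mx 1 y + b *: row_mx 1 z :> 'rV_(1 + n).
Proof. by move=> ab; rewrite !scale_row_mx add_row_mx -scalerDl ab scale1r. Qed.

(** The hull is the slice of the cone at height 1. For the inclusion of the slice in the hull,
    generators are added one at a time: the dehomogenization of a sum is the average of those of the
    summands, weighted by their heights. *)
Lemma convex_hull_cone (R : realType) n (L : seq 'rV[R]_(1 + n)) x :
  (forall g, g \in L -> 0 < lsubmx g 0 0) ->
  convex_hull ([set dehomog g | g in [set` L]] : set (convex_lmodType 'rV[R]_n)) x <->
  in_cone L (row_mx 1 x).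
Proof.
move=> L0; split.
  apply: (@convex_hull_sub _ _ _ (fun x => in_cone L (row_mx 1 x))).
    move=> y z a b hy hz a0 b0 ab.
    by rewrite row_mx1_comb //; apply: in_coneD; apply: in_coneZ.
  move=> _ [g /= gL <-]; have g0 := L0 g gL.
  rewrite row_mx1_dehomog ?gt_eqF //; apply: in_coneZ; first by rewrite invr_ge0 ltW.
  exact: in_cone_mem.
(* Partial sums have arbitrary height, so the claim covers all cone points; zero, which has no
   dehomogenization, is set apart. *)
set S := (X in convex_hull X); suff H : forall M, {subset M <= L} -> forall z, in_cone M z ->
    z = 0 \/ 0 < lsubmx z 0 0 /\ convex_hull S (dehomog z).
  move=> /(H L (fun _ => id))[|[_]]; last by rewrite dehomog_row_mx1.
  move=> /(congr1 (fun z => lsubmx z 0 0)); rewrite row_mxKl linear0 !mxE => /eqP.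
  by rewrite oner_eq0.
elim=> [|g M IH] ML z /=; first by left.
have gL : g \in L by apply: ML; rewrite mem_head.
have g0 := L0 g gL.
have hg : convex_hull S (dehomog g) by apply: sub_convex_hull; exists g.
case=> c; rewrite le_eqVlt => /orP[/eqP <-|c0].
  by rewrite scale0r subr0; apply: IH => h hM; apply: ML; rewrite inE hM orbT.
have /IH {}IH : {subset M <= L} by move=> h hM; apply: ML; rewrite inE hM orbT.
move=> /IH; set z' := z - c *: g; have zE : z = z' + c *: g by rewrite subrK.
case=> [z'0|[z'0 hz']]; right.
  rewrite zE z'0 add0r; rewrite linearZ mxE mulr_gt0 //; split => //.
  suff -> : dehomog (c *: g) = dehomog g by [].
  rewrite /dehomog !linearZ /= mxE scalerA invfM mulVKf //.
  by rewrite gt_eqF.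
have zl : lsubmx z 0 0 = lsubmx z' 0 0 + c * lsubmx g 0 0.
  by rewrite {1}zE linearD linearZ /= [LHS]mxE [X in _ + X]mxE.
have cg : 0 < c * lsubmx g 0 0 by rewrite mulr_gt0.
have z0 : 0 < lsubmx z 0 0 by rewrite zl addr_gt0.
split=> //.
have -> : dehomog z = (lsubmx z' 0 0 / lsubmx z 0 0) *: dehomog z' +
    (c * lsubmx g 0 0 / lsubmx z 0 0) *: dehomog g.
  rewrite {1}/dehomog {2}zE linearD linearZ /= scalerDr /dehomog !scalerA.
  congr (_ *: _ + _ *: _); first by rewrite mulrAC mulfV ?mul1r // gt_eqF.
  by rewrite mulrAC mulfK ?gt_eqF // mulrC.
apply: convex_hull_comb => //; rewrite ?divr_ge0 // ?ltW //.
by rewrite -mulrDl -zl mulfV // gt_eqF.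
Qed.

Lemma convex_hull_halfspaces (R : realType) n (L : seq 'rV[{poly rat}]_(1 + n)) :
  (forall g, g \in L -> \forall t \near \oo, 0 < peval R t (lsubmx g 0 0)) ->
  exists s : seq 'rV[{poly rat}]_(1 + n), \forall t \near \oo, forall x : 'rV[R]_n,
    convex_hull ([set dehomog (rveval R t g) | g in [set` L]] :
      set (convex_lmodType 'rV[R]_n)) x <->
    forall a, a \in s -> 0 <= dotv (rveval R t a) (row_mx 1 x).
Proof.
move=> /near_seq L0; have [s sH] := cone_halfspaces R _ L.
exists s; apply: filterS2 L0 sH => t L0 sH x; rewrite -sH -convex_hull_cone.
  have <- // : [set dehomog g | g in [set` map (rveval R t) L]] =
    [set dehomog (rveval R t g) | g in [set` L]].
  apply/seteqP; split => _ [g /= gL <-]; last by exists (rveval R t g); rewrite //= map_f.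
  by move: gL => /mapP[h hL ->]; exists h.
by move=> _ /mapP[g gL ->]; rewrite /rveval -map_lsubmx [ltRHS]mxE; exact: L0.
Qed.

(** * Midpoint-extreme lattice points *)

(** Repeated Euclidean division by [t]: the digits below [D] are remainders, and the last quotient,
    at most 1 in absolute value, carries the sign. *)
Lemma digit_expansion (t : int) D (x : int) : 0 < t -> `|x| <= t ^+ D ->
  exists2 y : 'I_D.+1 -> int, forall i, `|y i| <= t & x = \sum_i y i * t ^+ i.
Proof.
move=> t0; elim: D x => [|D IH] x xt.
  exists (fun _ => x) => [_|]; last by rewrite big_ord1 mulr1.
  by apply: le_trans xt _; rewrite expr0; lia.
have xE := divz_eq x t; have r0 := modz_ge0 x (lt0r_neq0 t0).
have r1 := ltz_pmod x t0.
have /IH[y yt yE] : `|(x %/ t)%Z| <= t ^+ D.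
  move: xt; rewrite exprS; move: (t ^+ D) => T xt.
  have h1 : (x %/ t)%Z * t <= T * t by lia.
  have h2 : (- T - 1) * t < (x %/ t)%Z * t by lia.
  by move: h1 h2; rewrite ler_pM2r // ltr_pM2r //; lia.
exists (fun i => if unlift ord0 i is Some k then y k else (x %% t)%Z).
  by move=> i; case: unliftP => [k _|_] //; rewrite ger0_norm // ltW.
rewrite big_ord_recl unlift_none mulr1 {1}xE addrC; congr (_ + _).
rewrite {1}yE mulr_suml; apply: eq_bigr => i _.
by rewrite liftK -mulrA -exprSr.
Qed.

Lemma integer_multiple N (a : 'rV[{poly rat}]_N) :
  exists (a' : 'rV[{poly int}]_N) (c : int), 0 < c /\
    forall i, c%:~R *: a 0 i = map_poly intr (a' 0 i).
Proof.
have /choice[f Hf] : forall i : 'I_N, exists qc : {poly int} * int,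
    0 < qc.2 /\ qc.2%:~R *: a 0 i = map_poly intr qc.1.
  move=> i; have [q [c c0 ->]] := rat_poly_scale (a 0 i).
  (* Squaring makes the multiplier positive, so that scaling preserves inequalities. *)
  exists (c *: q, c ^+ 2) => /=; split; first by rewrite exprn_even_gt0.
  rewrite scalerA expr2 intrM mulfK ?intr_eq0 //.
  by apply/polyP => j; rewrite !(coefZ, coef_map) /= rmorphM.
pose c := \prod_i (f i).2.
exists (\row_i (\prod_(j | j != i) (f j).2 *: (f i).1)), c.
split=> [|i]; first by apply: prodr_gt0 => i _; have [] := Hf i.
 rewrite mxE /c (bigD1 i) //= mulrC intrM -scalerA (Hf i).2.
by apply/polyP => j; rewrite !(coefZ, coef_map) /= rmorphM.
Qed.

Definition affz {n} (a : 'rV[{poly int}]_(1 + n)) (t : int) (x : 'rV[int]_n) : int :=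
  (a 0 (lshift n 0)).[t] + \sum_j x 0 j * (a 0 (rshift 1 j)).[t].

Lemma affz_dotv (R : realType) n (a : 'rV[{poly rat}]_(1 + n))
    (a' : 'rV[{poly int}]_(1 + n)) (c : int) t x :
  (forall i, c%:~R *: a 0 i = map_poly intr (a' 0 i)) ->
  c%:~R * dotv (rveval R t a) (row_mx 1 (map_mx intr x)) = (affz a' t%:Z x)%:~R.
Proof.
move=> Ha; have Hp i : c%:~R * peval R t (a 0 i) = (a' 0 i).[t%:Z]%:~R.
  have -> : c%:~R * peval R t (a 0 i) = peval R t (c%:~R *: a 0 i).
    by rewrite -mul_polyC rmorphM /= pevalC ratr_int.
  rewrite Ha pevalE -[t%:R]/(t%:Z%:~R) horner_map.
  by rewrite ratr_int.
rewrite dotvE big_split_ord /= big_ord1 /affz rmorphD /= mulrDr; congr (_ + _).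
  by rewrite row_mxEl !mxE eqxx mulr1 -[RHS]Hp.
rewrite rmorph_sum mulr_sumr; apply: eq_bigr => j _.
by rewrite row_mxEr !mxE mulrA Hp rmorphM mulrC.
Qed.

Lemma ultra_near (U : set_system nat) {UU : ProperFilter U} (t : nat -> nat) (P : nat -> Prop) :
  (forall N : nat, U [set m | (N <= t m)%N]) ->
  (\forall k \near \oo, P k) -> U [set m | P (t m)].
Proof. by move=> tU [N _ NP]; apply: filterS (tU N) => m; exact: NP. Qed.

Section Extreme.
Context {R : realType} {n : nat}.
Implicit Types (s : seq 'rV[{poly rat}]_(1 + n)).

Definition polyhedron s t : set 'rV[R]_n :=
  [set x | forall a, a \in s -> 0 <= dotv (rveval R t a) (row_mx 1 x)].

(* Weaker than being a vertex of the hull, but enough to span it for finite [S]. *)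
Definition midpoint_extreme (S : set 'rV[R]_n) : set 'rV[R]_n :=
  [set x | S x /\ forall u, S (x + u) -> S (x - u) -> u = 0].

Lemma lattice_pointP (x : 'rV[R]_n) :
  lattice_points R n x -> exists z : 'rV[int]_n, x = map_mx intr z.
Proof.
move=> xL; exists (\row_j Num.floor (x 0 j)); apply/rowP => j; rewrite !mxE.
by have := xL j; rewrite intrEfloor => /eqP.
Qed.

Lemma lattice_point_intr (z : 'rV[int]_n) : lattice_points R n (map_mx intr z).
Proof. by move=> j; rewrite mxE intr_int. Qed.

(** This is [lattice_dichotomy] applied to the base-[t] digits of the coordinates. A digit direction
    [u] yields the displacement [v], and slack at least the change in absolute value makes both
    [x + v] and [x - v] feasible. *)
Lemma polyhedron_ultra_dichotomy s D (U : set_system nat) {UU : UltraFilter U}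
    (t : nat -> nat) (x : nat -> 'rV[int]_n) :
  (forall N : nat, U [set m | (N <= t m)%N]) ->
  U [set m | forall j, `|x m 0 j| <= (t m)%:Z ^+ D] ->
  U [set m | polyhedron s (t m) (map_mx intr (x m))] ->
  (exists w : 'rV[{poly rat}]_n,
     U [set m | map_mx intr (x m) = polyvec_eval R w (t m)]) \/
  (exists v : nat -> 'rV[int]_n, U [set m |
     [/\ v m != 0, polyhedron s (t m) (map_mx intr (x m + v m)) &
      polyhedron s (t m) (map_mx intr (x m - v m))]]).
Proof.
move=> tU xD xs.
have /choice[f Hf] : forall l : 'I_(size s), exists ac : 'rV[{poly int}]_(1 + n) * int,
    0 < ac.2 /\ forall i, ac.2%:~R *: s`_l 0 i = map_poly intr (ac.1 0 i).
  by move=> l; have [a' [c [c0 Hc]]] := integer_multiple _ s`_l; exists (a', c).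
have polyE m z : polyhedron s m (map_mx intr z) <-> forall l, 0 <= affz (f l).1 m%:Z z.
  split=> [h l|h a /(nthP 0)[l ls <-]].
    have := h _ (mem_nth 0 (ltn_ord l)); have [c0 /affz_dotv] := Hf l.
    by move=> /(_ R m z); rewrite -(ler0z R) => <-; rewrite pmulr_rge0 ?ltr0z.
  have := h (Ordinal ls); have [c0 /affz_dotv] := Hf (Ordinal ls).
  by move=> /(_ R m z); rewrite -(ler0z R) => <-; rewrite pmulr_rge0 ?ltr0z.
have /choice[y Hy] : forall m, exists y : 'I_n * 'I_D.+1 -> int,
    (0 < t m)%N -> (forall j, `|x m 0 j| <= (t m)%:Z ^+ D) ->
    (forall c, `|y c| <= (t m)%:Z) /\
    forall j, x m 0 j = \sum_i y (j, i) * (t m)%:Z ^+ i.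
  move=> m; have [t0|nt] := boolP (0 < t m)%N; last by exists (fun=> 0).
  have [xm|nx] := pselect (forall j, `|x m 0 j| <= (t m)%:Z ^+ D); last by exists (fun=> 0).
  have /choice[y Hy] : forall j, exists y : 'I_D.+1 -> int,
      (forall i, `|y i| <= (t m)%:Z) /\ x m 0 j = \sum_i y i * (t m)%:Z ^+ i.
    by move=> j; have [y] := digit_expansion (t m)%:Z D _ t0 (xm j); exists y.
  by exists (fun c => y c.1 c.2) => _ _; split=> [c|j]; [have [] := Hy c.1|have [] := Hy j].
(* The digit of weight [t ^+ i] in coordinate [j] enters a constraint through the coefficient of
   that coordinate times ['X^i]. *)
pose A (l : 'I_(size s)) (c : 'I_n * 'I_D.+1) := (f l).1 0 (rshift 1 c.1) * 'X^(c.2).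
pose b (l : 'I_(size s)) := (f l).1 0 (lshift n 0).
have sumA (u : 'I_n * 'I_D.+1 -> int) l (k : int) : (\sum_c u c *: A l c).[k] =
    \sum_j (\sum_i u (j, i) * k ^+ i) * ((f l).1 0 (rshift 1 j)).[k].
  transitivity (\sum_c (u (c.1, c.2) *: A l (c.1, c.2)).[k]).
    by rewrite horner_sum; apply: eq_bigr => -[].
  rewrite -(pair_bigA _ (fun j i => (u (j, i) *: A l (j, i)).[k])) /=.
  apply: eq_bigr => j _; rewrite mulr_suml; apply: eq_bigr => i _.
  by rewrite hornerZ hornerM hornerXn mulrAC mulrA.
have GE m l : (0 < t m)%N -> (forall j, `|x m 0 j| <= (t m)%:Z ^+ D) ->
    (b l + \sum_c y m c *: A l c).[(t m)%:Z] = affz (f l).1 (t m)%:Z (x m).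
  move=> t0 xm; rewrite hornerD sumA; congr (_ + _); apply: eq_bigr => j _.
  by have [_ ->] := Hy m t0 xm.
have tU0 : U [set m | (0 < t m)%N] by exact: tU.
have tUZ (N : int) : U [set m | N < (t m)%:Z].
  by apply: filterS (tU `|N|.+1) => m /=; lia.
have yU : U [set m | forall c, `|y m c| <= (t m)%:Z].
  by apply: filterS2 tU0 xD => m t0 xm; have [] := Hy m t0 xm.
have GU : U [set m | forall l, 0 <= (b l + \sum_c y m c *: A l c).[(t m)%:Z]].
  apply: filterS2 (filterI tU0 xD) xs => m [t0 xm] /polyE h l.
  by rewrite GE.
have [[w Hw]|[u [[j0 i0] u0] Hu]] := lattice_dichotomy _ _ A b U _ _ tUZ yU GU.
  left; exists (\row_j \sum_i w (j, i) * 'X^i).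
  apply: filterS2 (filterI tU0 xD) Hw => m [t0 xm] wm.
  have [_ Hx] := Hy m t0 xm; apply/rowP => j; rewrite !mxE Hx horner_sum !rmorph_sum /=.
  apply: eq_bigr => i _; rewrite hornerM hornerXn -[(t m)%:R]/((t m)%:Z%:~R) wm.
  by rewrite [RHS]rmorphM [X in _ = _ * X]rmorphXn /= !ratr_int rmorphM rmorphXn.
right; pose v m : 'rV[int]_n := \row_j \sum_i u (j, i) * (t m)%:Z ^+ i; exists v.
have vU : U [set m | v m != 0].
  (* Nonzero digits may cancel at particular [t], but a coordinate of [v] is a nonzero polynomial in
     [t], hence nonzero for large [t]. *)
  pose q := \poly_(i < D.+1) ((u (j0, inord i))%:~R : rat).
  have qE (m : nat) : q.[m%:R] = (\sum_i u (j0, i) * m%:Z ^+ i)%:~R.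
    rewrite horner_poly rmorph_sum; apply: eq_bigr => i _.
    by rewrite inord_val rmorphM rmorphXn.
  have q0 : q != 0.
    apply/eqP => /(congr1 (fun p : {poly rat} => p`_i0)) /eqP.
    by rewrite coef_poly ltn_ord coef0 inord_val intr_eq0 (negbTE u0).
  apply: filterS (ultra_near U t _ tU (peval_neq0 R _ q0)) => m /=.
  apply: contraNneq => vm0; rewrite pevalE qE.
  by have /rowP/(_ j0) := vm0; rewrite !mxE => ->; rewrite rmorph0.
apply: filterS2 (filterI (filterI tU0 xD) vU) Hu => m [[t0 xm] v0] Hm; split => //.
  apply/polyE => l; have := Hm l; rewrite GE // sumA => h.
  have -> : affz (f l).1 (t m)%:Z (x m + v m) = affz (f l).1 (t m)%:Z (x m) +
      \sum_j (\sum_i u (j, i) * (t m)%:Z ^+ i) * ((f l).1 0 (rshift 1 j)).[(t m)%:Z].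
    by rewrite /affz -addrA -big_split; congr (_ + _); apply: eq_bigr => j _; rewrite !mxE mulrDl.
  by lia.
apply/polyE => l; have := Hm l; rewrite GE // sumA => h.
have -> : affz (f l).1 (t m)%:Z (x m - v m) = affz (f l).1 (t m)%:Z (x m) -
    \sum_j (\sum_i u (j, i) * (t m)%:Z ^+ i) * ((f l).1 0 (rshift 1 j)).[(t m)%:Z].
  by rewrite /affz -addrA -sumrB; congr (_ + _); apply: eq_bigr => j _; rewrite !mxE mulrBl.
by lia.
Qed.

(** Compactness by contradiction. If no finite list suffices, some pair [(t, x)] with [t >= m]
    escapes the list [F m] for every [m]. Along an ultrafilter, either [x] follows one polynomial
    vector, which belongs to [F m] for large [m], or [x] is a midpoint. *)
Lemma midpoint_extreme_candidates s D (P : nat -> set 'rV[R]_n) :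
  (\forall t \near \oo, P t = polyhedron s t) ->
  (\forall t \near \oo, forall x j, P t x -> `|x 0 j| <= t%:R ^+ D) ->
  exists F : seq 'rV[{poly rat}]_n, \forall t \near \oo,
    forall x, midpoint_extreme (P t `&` lattice_points R n) x ->
    exists2 w, w \in F & x = polyvec_eval R w t.
Proof.
move=> Ps PD; apply: contrapT => nF.
(* Polynomial vectors are countable; [F m] lists those with code below [m]. *)
pose F m : seq 'rV[{poly rat}]_n := pmap unpickle (iota 0 m).
have /choice[tx Htx] : forall m, exists tx : nat * 'rV[int]_n,
    [/\ (m <= tx.1)%N, midpoint_extreme (P tx.1 `&` lattice_points R n) (map_mx intr tx.2) &
     forall w, w \in F m -> map_mx intr tx.2 <> polyvec_eval R w tx.1].
  move=> m; apply: contrapT => nm; apply: nF; exists (F m); near=> t => x xP.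
  apply: contrapT => nw; have [[_ /lattice_pointP[z xz]] _] := xP.
  apply: nm; exists (t, z); split => /=.
  - by near: t; exact: nbhs_infty_ge.
  - by rewrite -xz.
  - by move=> w wF; rewrite -xz => xw; apply: nw; exists w.
have [U [UU ooU]] : exists U : set_system nat, UltraFilter U /\ \oo `<=` U.
  exact: ultraFilterLemma eventually_filter.
pose t m := (tx m).1; pose x m := (tx m).2.
have tU N : U [set m | (N <= t m)%N].
  apply: ooU; apply: filterS (nbhs_infty_ge N) => m /= Nm.
  by apply: leq_trans Nm _; have [] := Htx m.
have PU : U [set m | P (t m) = polyhedron s (t m)] by exact: ultra_near tU Ps.
have xD : U [set m | forall j, `|x m 0 j| <= (t m)%:Z ^+ D].
  apply: filterS (ultra_near U t _ tU PD) => m Dm j; have [_ [[xP _] _] _] := Htx m.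
  by have := Dm _ j xP; rewrite mxE -intr_norm -[(t m)%:R]/((t m)%:Z%:~R) -rmorphXn ler_int.
have xs : U [set m | polyhedron s (t m) (map_mx intr (x m))].
  by apply: filterS PU => m /= <-; have [_ [[xP _] _] _] := Htx m.
have [[w Hw]|[v Hv]] := polyhedron_ultra_dichotomy s D U t x tU xD xs.
  have wU : U [set m | (pickle w < m)%N] by apply: ooU; exact: nbhs_infty_gt.
  have [m [/= xw wm]] := filter_ex (filterI Hw wU).
  have [_ _ /(_ w)] := Htx m; apply => //.
  by rewrite mem_pmap; apply/mapP; exists (pickle w); rewrite ?mem_iota ?pickleK.
have [m [/= PE [v0 vp vm]]] := filter_ex (filterI PU Hv).
have [_ [_ xext] _] := Htx m; have := xext (map_mx intr (v m)).
have xpE : map_mx intr (x m) + map_mx intr (v m) = map_mx intr (x m + v m) :> 'rV[R]_n.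
  by apply/rowP => j; rewrite !mxE rmorphD.
have xmE : map_mx intr (x m) - map_mx intr (v m) = map_mx intr (x m - v m) :> 'rV[R]_n.
  by apply/rowP => j; rewrite !mxE rmorphB.
rewrite -/(t m) -/(x m) xpE xmE PE => h.
have /rowP vm0 : map_mx intr (v m) = 0 :> 'rV[R]_n.
  by apply: h; split => //; exact: lattice_point_intr.
case/eqP: v0; apply/rowP => j; have := vm0 j; rewrite !mxE => /eqP.
by rewrite intr_eq0 => /eqP.
Unshelve. all: by end_near. Qed.
End Extreme.

(** * Vertices of the integer hull *)

Lemma ratfun_den_neq0 (F : fieldType) (f : {fraction {poly F}}) : ratfun_den f != 0.
Proof.
have d0 : (repr f).2 != 0 by exact: denom_ratioP.
by rewrite /ratfun_den dvdp_div_eq0 ?dvdp_gcdr.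
Qed.

Section IntegerHull.
Context {R : realType} {n : nat}.

Lemma polyvec_evalE (w : 'rV[{poly rat}]_n) t : polyvec_eval R w t = rveval R t w.
Proof. by apply/rowP => j; rewrite !mxE. Qed.

Lemma dehomog_polyvec (w : 'rV[{poly rat}]_n) t :
  dehomog (rveval R t (row_mx 1 w)) = polyvec_eval R w t.
Proof. by rewrite /rveval map_row_mx map_mx1 dehomog_row_mx1 polyvec_evalE. Qed.

Lemma ratvec_homogenize (v : 'rV[{fraction {poly rat}}]_n) :
  exists g : 'rV[{poly rat}]_(1 + n), \forall t \near \oo,
    [/\ ratvec_defined v t, 0 < peval R t (lsubmx g 0 0) &
        dehomog (rveval R t g) = ratvec_eval R v t].
Proof.
pose den j := ratfun_den (v 0 j).
(* Squares make the common denominator positive wherever no [den j] vanishes, as a height must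
   be. *)
pose q := \prod_j den j ^+ 2.
pose p := \row_j (ratfun_num (v 0 j) * den j * \prod_(j' | j' != j) den j' ^+ 2).
exists (row_mx q%:M p).
have den0 : \forall t \near \oo, forall j, peval R t (den j) != 0.
  by apply: filter_forall => j; apply: peval_neq0; exact: ratfun_den_neq0.
apply: filterS den0 => t den0.
have q0 : 0 < peval R t q.
  rewrite rmorph_prod; apply: prodr_gt0 => j _.
  by rewrite rmorphXn exprn_even_gt0 //=; exact: den0.
split; first by move=> j; have := den0 j; rewrite pevalE fmorph_eq0.
  by rewrite row_mxKl mxE eqxx mulr1n.
rewrite /dehomog /rveval map_row_mx row_mxKl row_mxKr map_scalar_mx.
apply/rowP => j; rewrite [LHS]mxE [in LHS]mxE eqxx mulr1n [in LHS]mxE [in LHS]mxE.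
rewrite [RHS]mxE /ratfun_eval fmorph_div /= -!pevalE -/(den j) /q.
rewrite (bigD1 j) //= !rmorphM /=.
have r0 : peval R t (\prod_(j' | j' != j) den j' ^+ 2) != 0.
  rewrite rmorph_prod; apply/prodf_neq0 => i _.
  by rewrite rmorphXn expf_neq0 //; exact: den0.
have := den0 j; move: r0; set a := peval R t _; set b := peval R t _.
by move=> a0 b0; field; rewrite a0 b0.
Qed.

Lemma ratfun_bound (f : {fraction {poly rat}}) : exists D : nat, \forall t \near \oo,
  `|ratr (ratfun_eval f t%:R) : R| <= t%:R ^+ D.
Proof.
have [D HD] := peval_upper_bound R (ratfun_num f).
have [e e0 He] := peval_lower_bound R _ (ratfun_den_neq0 _ f).
have {}He : \forall t \near \oo, e <= `|peval R t (ratfun_den f)|.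
  case: He => He; apply: filterS He => t He; first by apply: le_trans (ler_norm _).
  by rewrite -normrN; apply: le_trans (ler_norm _); rewrite lerNr.
(* The extra power absorbs [e^-1], which bounds the inverse of the denominator. *)
exists D.+1; near=> t.
have h1 : `|peval R t (ratfun_num f)| <= t%:R ^+ D by near: t.
have h2 : e <= `|peval R t (ratfun_den f)| by near: t.
have h3 : e^-1 <= t%:R :> R by near: t; exact: near_natr_ge.
rewrite /ratfun_eval rmorphM fmorphV /= -!pevalE normrM normfV exprSr.
apply: ler_pM => //; rewrite ?invr_ge0 //.
by apply: le_trans h3; rewrite lef_pV2 ?posrE //; exact: lt_le_trans h2.
Unshelve. all: by end_near. Qed.

Lemma polytope_family_bound k (v : 'I_k -> 'rV[{fraction {poly rat}}]_n) :
  exists D : nat, \forall t \near \oo, forall (x : 'rV[R]_n) j,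
    polytope_family R v t x -> `|x 0 j| <= t%:R ^+ D.
Proof.
have /choice[D HD] : forall ij : 'I_k * 'I_n, exists D : nat, \forall t \near \oo,
    `|ratr (ratfun_eval (v ij.1 0 ij.2) t%:R) : R| <= t%:R ^+ D.
  by move=> ij; exact: ratfun_bound.
exists (\max_ij D ij)%N.
have {}HD : \forall t \near \oo, forall ij : 'I_k * 'I_n,
    `|ratr (ratfun_eval (v ij.1 0 ij.2) t%:R) : R| <= t%:R ^+ D ij.
  exact: filter_forall.
apply: filterS2 (nbhs_infty_ge 1) HD => t t1 Ht x j.
move: x; apply: convex_hull_sub => [x y a b hx hy a0 b0 ab|_ [i _ <-]].
  rewrite !mxE -[leRHS]mul1r -[X in _ <= X * _]ab mulrDl; apply: le_trans (ler_normD _ _) _.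
  by rewrite !normrM (ger0_norm a0) (ger0_norm b0); apply: lerD; rewrite ler_wpM2l.
rewrite mxE; apply: le_trans (Ht (i, j)) _.
by rewrite ler_weXn2l ?ler1n //; exact: leq_bigmax.
Qed.

Lemma lattice_box_finite (S : set 'rV[R]_n) (N : nat) :
  S `<=` lattice_points R n -> (forall x j, S x -> `|x 0 j| <= N%:R) -> finite_set S.
Proof.
move=> SL SN.
pose g (z : {ffun 'I_n -> 'I_(N + N).+1}) : 'rV[R]_n := \row_j ((z j)%:R - N%:R).
apply: (@sub_finite_set _ _ (g @` setT)); last exact/finite_image/finite_finset.
move=> x Sx; have [z xz] := lattice_pointP _ (SL _ Sx).
exists [ffun j => inord `|(z 0 j + N%:Z)|] => //.
apply/rowP => j; rewrite !mxE ffunE.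
have := SN x j Sx; rewrite xz mxE -intr_norm -[N%:R]/(N%:Z%:~R) ler_int => zN.
rewrite inordK; last by lia.
rewrite -[(absz _)%:R]/((absz _)%:Z%:~R) -rmorphB /=; congr _%:~R; lia.
Qed.

(* Among the minimizers of the linear form, one of maximal Euclidean norm is not
   the midpoint of two other points, by the parallelogram identity. *)
Lemma midpoint_extreme_minimizes (S : set 'rV[R]_n) (a : 'rV[R]_(1 + n)) :
  finite_set S ->
  (forall x, midpoint_extreme S x -> 0 <= dotv a (row_mx 1 x)) ->
  forall x, S x -> 0 <= dotv a (row_mx 1 x).
Proof.
move=> /finite_seqP[L SE] Sext x0 Sx0; pose f x := dotv a (row_mx 1 x).
have memL x : S x = (x \in L) by rewrite SE.
have [x1 x1L x1min] := argmax_seq _ _ (fun x => - f x) x0 L.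
have x0L : x0 \in L by rewrite -memL.
have consL y : (y \in x0 :: L) = (y \in L).
  by rewrite inE; case: eqP => // ->; rewrite x0L.
rewrite consL in x1L.
have {}x1min y : S y -> f x1 <= f y.
  by rewrite memL => yL; rewrite -lerN2; apply: x1min; rewrite consL.
have [x2 +] := argmax_seq _ _ (fun x => dotv x x) x1 [seq y <- L | f y == f x1].
have consM y : (y \in x1 :: [seq y <- L | f y == f x1]) = (y \in L) && (f y == f x1).
  by rewrite inE mem_filter andbC; case: eqP => //= ->; rewrite x1L eqxx.
rewrite consM => /andP[x2L /eqP f2] x2max.
suff ext : midpoint_extreme S x2.
  by apply: le_trans (Sext _ ext) _; rewrite -/(f x2) f2 x1min.
split; first by rewrite memL.
move=> u up um.
have fD : f (x2 + u) + f (x2 - u) = f x1 + f x1.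
  rewrite -f2 /f -!dotvDr; congr dotv.
  by rewrite !add_row_mx; congr row_mx; rewrite addrACA subrr addr0.
have fp := x1min _ up; have fm := x1min _ um.
have qp : dotv (x2 + u) (x2 + u) <= dotv x2 x2.
  apply: x2max; rewrite consM; apply/andP; split; first by rewrite -memL.
  by apply/eqP; lra.
have qm : dotv (x2 - u) (x2 - u) <= dotv x2 x2.
  apply: x2max; rewrite consM; apply/andP; split; first by rewrite -memL.
  by apply/eqP; lra.
have : dotv u u <= 0.
  by move: qp qm; rewrite !(dotvDl, dotvDr, dotvNl, dotvNr); lra.
rewrite dotvE => u0; apply/rowP => j; rewrite mxE; apply/eqP; rewrite -sqrf_eq0 expr2.
rewrite eq_le sqr_ge0 andbT; apply: le_trans u0; rewrite (bigD1 j) //= lerDl.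
by apply: sumr_ge0 => i _; exact: sqr_ge0.
Qed.

(** The affine form attains its minimum over the hull at [x] only, so a proper convex combination
    equal to [x] has both ends equal to [x]. *)
Lemma separated_vertex (A : set 'rV[R]_n) x (a : 'rV[R]_(1 + n)) :
  A x -> dotv a (row_mx 1 x) < 0 ->
  (forall y, A y -> y <> x -> 0 <= dotv a (row_mx 1 y)) ->
  vertices (convex_hull (A : set (convex_lmodType 'rV[R]_n))) x.
Proof.
move=> Ax; pose f y := dotv a (row_mx 1 y); rewrite -/(f x) => fx fA.
have f_comb y z (c d : R) : c + d = 1 -> f (c *: y + d *: z) = c * f y + d * f z.
  by move=> cd; rewrite /f row_mx1_comb // dotvDr !dotvZr.
have hullC y : convex_hull (A : set (convex_lmodType 'rV[R]_n)) y -> y = x \/ f x < f y.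
  move: y; apply: convex_hull_sub => [y z c d hy hz c0 d0 cd|y Ay]; last first.
    by have [->|/eqP yx] := eqVneq y x; [left|right; apply: lt_le_trans fx _; exact: fA].
  have fy : f x <= f y by case: hy => [->//|/ltW].
  have fz : f x <= f z by case: hz => [->//|/ltW].
  have [cE|cn] := eqVneq c 0.
    by move: cd; rewrite cE add0r => ->; rewrite scale0r add0r scale1r.
  have [dE|dn] := eqVneq d 0.
    by move: cd; rewrite dE addr0 => ->; rewrite scale0r addr0 scale1r.
  have {}c0 : 0 < c by rewrite lt_def cn.
  have {}d0 : 0 < d by rewrite lt_def dn.
  rewrite f_comb // -[f x]mul1r -cd mulrDl.
  case: hy => [->|hy].
    case: hz => [->|hz]; first by left; rewrite -scalerDl cd scale1r.
    by right; rewrite ltrD2l ltr_pM2l.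
  by right; rewrite ltr_leD // ?ltr_pM2l // ler_pM2l.
split=> [|y z l hy hz /andP[l0 l1] xE]; first exact: sub_convex_hull.
have fE : f x = l%:num * f y + (1 - l%:num) * f z.
  by rewrite -f_comb ?{1}xE // addrC subrK.
have c0 : 0 < 1 - l%:num by rewrite subr_gt0.
have [yx|fy] := hullC y hy; have [zx|fz] := hullC z hz; first by rewrite yx zx.
- by exfalso; move: fE; rewrite yx; nra.
- by exfalso; move: fE; rewrite zx; nra.
by exfalso; nra.
Qed.
End IntegerHull.

(** * Residue classes and eventual decisions *)

Lemma horner_int_mod (p : {poly int}) (d x y : int) :
  (d %| x - y)%Z -> (d %| p.[x] - p.[y])%Z.
Proof.
move=> dxy; elim/poly_ind: p => [|p c IH]; first by rewrite !horner0 subr0 dvdz0.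
rewrite !hornerMXaddC.
have -> : p.[x] * x + c - (p.[y] * y + c) = (p.[x] - p.[y]) * x + p.[y] * (x - y) by ring.
by apply: rpredD; [exact: dvdz_mulr|exact: dvdz_mull].
Qed.

Section Residues.
Context {R : realType} {n : nat}.

(** With [p = q / c] and [q] integral, the modulus [|c|] works: congruent arguments change [q] by a
    multiple of [c], hence [p] by an integer. *)
Lemma peval_int_mod (p : {poly rat}) : exists2 d : nat, (0 < d)%N &
  forall t t', t = t' %[mod d] -> peval R t p \is a Num.int -> peval R t' p \is a Num.int.
Proof.
have [q [c c0 pE]] := rat_poly_scale p.
have peE t : peval R t p = c%:~R^-1 * q.[t%:Z]%:~R.
  rewrite pE -mul_polyC rmorphM /= pevalC fmorphV /= ratr_int pevalE.
  by rewrite -[t%:R]/(t%:Z%:~R) horner_map ratr_int.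
exists `|c|%N => [|t t' tt' pt]; first by rewrite absz_gt0.
have /(horner_int_mod q) : (c %| t'%:Z - t%:Z)%Z.
  rewrite -eqz_mod_dvd -(modz_abs _ c) -(modz_abs t%:Z) !modz_nat.
  by rewrite eqz_nat eq_sym; apply/eqP.
move=> /dvdzP[k kE].
have -> : peval R t' p = peval R t p + k%:~R.
  rewrite !peE; have -> : q.[t'%:Z] = q.[t%:Z] + k * c by rewrite -kE addrC subrK.
  by rewrite intrD intrM mulrDr (mulrC k%:~R) mulKf // intr_eq0.
by rewrite rpredD // intr_int.
Qed.

Lemma lattice_point_mod (F : seq 'rV[{poly rat}]_n) : exists2 d : nat, (0 < d)%N &
  forall w, w \in F -> forall t t', t = t' %[mod d] ->
    lattice_points R n (polyvec_eval R w t) -> lattice_points R n (polyvec_eval R w t').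
Proof.
elim: F => [|w F [d d0 Hd]]; first by exists 1%N.
have /choice[e He] : forall j, exists e : nat, (0 < e)%N /\
    forall t t', t = t' %[mod e] ->
      peval R t (w 0 j) \is a Num.int -> peval R t' (w 0 j) \is a Num.int.
  by move=> j; have [e] := peval_int_mod (w 0 j); exists e.
pose E := (\prod_j e j)%N.
have E0 : (0 < E)%N by rewrite prodn_gt0 // => j; have [] := He j.
have modW a b t t' : (t = t' %[mod a * b] -> t = t' %[mod b])%N.
  by move=> tt'; rewrite -(modn_dvdm t (dvdn_mull a (dvdnn b))) tt' modn_dvdm // dvdn_mull.
exists (E * d)%N; first by rewrite muln_gt0 E0.
move=> w'; rewrite inE => /orP[/eqP ->|w'F] t t' tt'; last first.
  by apply: Hd => //; exact: modW tt'.
move=> wt j; have := wt j; rewrite !mxE -!pevalE; apply: (He j).2.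
have : t = t' %[mod E] by apply: (modW d); rewrite mulnC.
by rewrite /E (bigD1 j) //= mulnC; exact: modW.
Qed.

(** Each constraint at [w] is a polynomial in [t], whose sign is eventually constant; there are
    finitely many constraints. *)
Lemma polyhedron_decided (s : seq 'rV[{poly rat}]_(1 + n)) (w : 'rV[{poly rat}]_n) :
  (\forall t \near \oo, polyhedron s t (polyvec_eval R w t)) \/
  (\forall t \near \oo, ~ polyhedron s t (polyvec_eval R w t)).
Proof.
have dE a t : dotv (rveval R t a) (row_mx 1 (polyvec_eval R w t)) =
    peval R t (dotv a (row_mx 1 w)).
  by rewrite peval_dotv /rveval map_row_mx map_mx1 polyvec_evalE.
have [[a [sa Ha]]|H] := pselect (exists a, a \in s /\
    \forall t \near \oo, peval R t (dotv a (row_mx 1 w)) < 0).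
  right; apply: filterS Ha => t + /(_ a sa); rewrite dE.
  by move=> /lt_le_trans/[apply]; rewrite ltxx.
left; apply: near_seq => a sa.
have [Ha|Ha] := peval_ge0_decided R (dotv a (row_mx 1 w)).
  by apply: filterS Ha => t; rewrite dE.
by exfalso; apply: H; exists a.
Qed.

Lemma polyvec_hull_halfspaces (F : seq 'rV[{poly rat}]_n) :
  exists s, \forall t \near \oo,
    convex_hull ([set polyvec_eval R w t | w in [set` F]] :
      set (convex_lmodType 'rV[R]_n)) = polyhedron s t.
Proof.
have [|s Hs] := convex_hull_halfspaces R n [seq row_mx 1 w | w <- F].
  move=> _ /mapP[w _ ->]; apply: filterE => t.
  by rewrite row_mxKl mxE eqxx rmorph1.
exists s; apply: filterS Hs => t Hs; apply/seteqP.
have -> : [set polyvec_eval R w t | w in [set` F]] =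
    [set dehomog (rveval R t g) | g in [set` [seq row_mx 1 w | w <- F]]].
  apply/seteqP; split=> _ [w /= wF <-].
    by exists (row_mx 1 w); rewrite ?dehomog_polyvec //= map_f.
  by move: wF => /mapP[w' w'F ->]; exists w'; rewrite ?dehomog_polyvec.
by split=> x /Hs.
Qed.

Lemma polytope_family_halfspaces k (v : 'I_k -> 'rV[{fraction {poly rat}}]_n) :
  exists s, \forall t \near \oo,
    (forall i, ratvec_defined (v i) t) /\ polytope_family R v t = polyhedron s t.
Proof.
have /choice[g Hg] : forall i, exists g : 'rV[{poly rat}]_(1 + n), \forall t \near \oo,
    [/\ ratvec_defined (v i) t, 0 < peval R t (lsubmx g 0 0) &
        dehomog (rveval R t g) = ratvec_eval R (v i) t].
  by move=> i; exact: ratvec_homogenize.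
have [|s Hs] := convex_hull_halfspaces R n [seq g i | i <- enum 'I_k].
  by move=> _ /mapP[i _ ->]; apply: filterS (Hg i) => t [].
exists s; have {}Hg : \forall t \near \oo, forall i,
    [/\ ratvec_defined (v i) t, 0 < peval R t (lsubmx (g i) 0 0) &
        dehomog (rveval R t (g i)) = ratvec_eval R (v i) t] by exact: filter_forall.
apply: filterS2 Hg Hs => t Hg Hs; split; first by move=> i; have [] := Hg i.
rewrite /polytope_family.
have -> : range (fun i => ratvec_eval R (v i) t) =
    [set dehomog (rveval R t h) | h in [set` [seq g i | i <- enum 'I_k]]].
  apply/seteqP; split=> [_ [i _ <-]|_ [h /= /mapP[i _ ->] <-]].
    by have [_ _ <-] := Hg i; exists (g i); rewrite //= map_f // mem_enum.
  by have [_ _ ->] := Hg i; exists i.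
by apply/seteqP; split=> x /Hs.
Qed.

Lemma polyvec_eval_eventually_inj (F : seq 'rV[{poly rat}]_n) :
  \forall t \near \oo, {in F &, injective (fun w => polyvec_eval R w t)}.
Proof.
have : \forall t \near \oo, forall w, w \in F -> forall w', w' \in F ->
    polyvec_eval R w t = polyvec_eval R w' t -> w = w'.
  apply: near_seq => w _; apply: near_seq => w' _.
  have [->|ww'] := eqVneq w w'; first exact: filterE.
  have /rV0Pn[j] : w - w' != 0 by rewrite subr_eq0.
  rewrite !mxE => /(peval_neq0 R); apply: filterS => t wt /rowP/(_ j).
  rewrite !mxE -!pevalE => wE; move: wt.
  by rewrite rmorphD rmorphN /= wE subrr eqxx.
by apply: filterS => t H w w' wF w'F; exact: H.
Qed.

(** A candidate is eventually a vertex exactly when it lies outside the hull of the others, which is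
    eventually decided. Outside, a violated half-space separates it; inside, dropping it leaves the
    hull unchanged, so every vertex is another candidate. *)
Lemma vertices_polyvec_hull (F : seq 'rV[{poly rat}]_n) :
  exists2 G : seq 'rV[{poly rat}]_n, uniq G & \forall t \near \oo,
    {in G &, injective (fun w => polyvec_eval R w t)} /\
    vertices (convex_hull ([set polyvec_eval R w t | w in [set` F]] :
      set (convex_lmodType 'rV[R]_n))) = [set polyvec_eval R w t | w in [set` G]].
Proof.
pose oth w := [seq w' <- F | w' != w].
have /choice[s Hs] := fun w => polyvec_hull_halfspaces (oth w).
pose isv w := `[< \forall t \near \oo, ~ polyhedron (s w) t (polyvec_eval R w t) >].
exists (undup [seq w <- F | isv w]); first exact: undup_uniq.
have H : \forall t \near \oo, forall w, w \in F ->
    [/\ convex_hull ([set polyvec_eval R w t | w in [set` oth w]] :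
      set (convex_lmodType 'rV[R]_n)) = polyhedron (s w) t,
     isv w -> ~ polyhedron (s w) t (polyvec_eval R w t) &
     ~~ isv w -> polyhedron (s w) t (polyvec_eval R w t)].
  apply: near_seq => w _.
  have [Hw|Hw] := polyhedron_decided (s w) w.
    apply: filterS2 (Hs w) (Hw) => t st wt; split => // /asboolP nw.
    by have [t' [h1 h2]] := filter_ex (filterI Hw nw); have := h2 h1.
  apply: filterS2 (Hs w) (Hw) => t st wt; split => // /asboolP nw.
  by exfalso; exact: nw.
apply: filterS2 H (polyvec_eval_eventually_inj F) => t H inj.
split.
  by move=> w w'; rewrite !mem_undup !mem_filter => /andP[_ wF] /andP[_ w'F]; exact: inj.
apply/seteqP; split=> [x xv|_ [w /= + <-]]; last first.
  rewrite mem_undup mem_filter => /andP[vw wF].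
  have [hE /(_ vw) nw _] := H w wF.
  have [a [sa fa]] : exists a, a \in s w /\
      dotv (rveval R t a) (row_mx 1 (polyvec_eval R w t)) < 0.
    apply: contrapT => na; apply: nw => a sa; rewrite leNgt; apply/negP => fa.
    by apply: na; exists a.
  apply: (separated_vertex _ _ (rveval R t a)) => //; first by exists w.
  move=> _ [w' /= w'F <-] ww'; suff : polyhedron (s w) t (polyvec_eval R w' t) by apply.
  rewrite -hE; apply: sub_convex_hull; exists w' => //=.
  by rewrite mem_filter w'F andbT; apply/eqP => w'E; apply: ww'; rewrite w'E.
have [w /= wF wx] := vertices_convex_hull_sub _ _ xv.
exists w => //=; rewrite mem_undup mem_filter wF andbT; apply: contrapT => /negP vw.
have [hE _ /(_ vw) wp] := H w wF.
have hullE : convex_hull ([set polyvec_eval R w t | w in [set` F]] :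
      set (convex_lmodType 'rV[R]_n)) =
    convex_hull ([set polyvec_eval R w t | w in [set` oth w]] :
      set (convex_lmodType 'rV[R]_n)).
  apply/seteqP; split; apply: convex_hull_mono => _ [w' /= w'F <-].
    have [->|ww'] := eqVneq w' w; first by rewrite hE.
    by apply: sub_convex_hull; exists w' => //=; rewrite mem_filter ww'.
  apply: sub_convex_hull; exists w' => //=.
  by move: w'F; rewrite mem_filter => /andP[].
move: xv; rewrite hullE => /vertices_convex_hull_sub[w' /=].
rewrite mem_filter => /andP[ww' w'F] w'x; case/eqP: ww'.
by apply: inj => //; rewrite w'x.
Qed.

End Residues.

(** * Candidates surviving in a residue class span the integer hull *)

Theorem theorem5p2 (R : realType) (n k : nat)
    (v : 'I_k -> 'rV[{fraction {poly rat}}]_n) :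
  exists2 d : nat, (0 < d)%N &
    forall r : nat, (r < d)%N ->
      exists (z : nat) (w : 'I_z -> 'rV[{poly rat}]_n),
        \forall t \near \oo, t = r %[mod d] ->
          [/\ forall i : 'I_k, ratvec_defined (v i) t,
              injective (fun j : 'I_z => polyvec_eval R (w j) t)
            & vertices (convex_hull
                (polytope_family R v t `&` lattice_points R n))
              = range (fun j : 'I_z => polyvec_eval R (w j) t)].
Proof.
have [s Hs] := @polytope_family_halfspaces R n k v.
have [D HD] := @polytope_family_bound R n k v.
have [F HF] : exists F : seq 'rV[{poly rat}]_n, \forall t \near \oo,
    forall x, midpoint_extreme (polytope_family R v t `&` lattice_points R n) x ->
    exists2 w, w \in F & x = polyvec_eval R w t.
  apply: (midpoint_extreme_candidates s D) => //.
  by apply: filterS Hs => t [].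
have [d d0 Hd] := @lattice_point_mod R n F.
exists d => // r _.
pose inP w := `[< \forall t \near \oo, polyhedron s t (polyvec_eval R w t) >].
(* Integrality is tested at [r] itself and transfers to the whole residue class by [Hd]; membership
   in the polytope is the eventual one. *)
pose F' := [seq w <- F | `[< lattice_points R n (polyvec_eval R w r) >] && inP w].
have HP : \forall t \near \oo, forall w, w \in F ->
    (inP w -> polyhedron s t (polyvec_eval R w t)) /\
    (~~ inP w -> ~ polyhedron s t (polyvec_eval R w t)).
  apply: near_seq => w _; have [Hw|Hw] := @polyhedron_decided R n s w.
    by apply: filterS (Hw) => t wt; split => // /asboolP nw; exfalso; exact: nw.
  apply: filterS (Hw) => t wt; split => // /asboolP nw.
  have [t' [h1 h2]] := filter_ex (filterI nw Hw); exfalso; exact: h2 h1.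
have [s' Hs'] := @polyvec_hull_halfspaces R n F'.
have [G uG HG] := @vertices_polyvec_hull R n F'.
exists (size G), (fun j => G`_j).
near=> t => tr.
have [vdef PE] : (forall i, ratvec_defined (v i) t) /\ polytope_family R v t = polyhedron s t.
  by near: t.
have PD : forall (x : 'rV[R]_n) j, polytope_family R v t x -> `|x 0 j| <= t%:R ^+ D.
  by near: t.
have cand : forall x, midpoint_extreme (polytope_family R v t `&` lattice_points R n) x ->
    exists2 w, w \in F & x = polyvec_eval R w t by near: t.
have inPt : forall w, w \in F -> (inP w -> polyhedron s t (polyvec_eval R w t)) /\
    (~~ inP w -> ~ polyhedron s t (polyvec_eval R w t)) by near: t.
have hullF' : convex_hull ([set polyvec_eval R w t | w in [set` F']] :
      set (convex_lmodType 'rV[R]_n)) = polyhedron s' t by near: t.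
have [injG vertG] : {in G &, injective (fun w => polyvec_eval R w t)} /\
    vertices (convex_hull ([set polyvec_eval R w t | w in [set` F']] :
      set (convex_lmodType 'rV[R]_n))) = [set polyvec_eval R w t | w in [set` G]].
  by near: t.
split=> //.
  move=> i j /= /injG; rewrite !mem_nth // => /(_ isT isT) ij.
  by apply/val_inj/eqP; rewrite -(nth_uniq 0 _ _ uG) ?ltn_ord //; exact/eqP.
have -> : range (fun j : 'I_(size G) => polyvec_eval R G`_j t) =
    [set polyvec_eval R w t | w in [set` G]].
  apply/seteqP; split=> [_ [j _ <-]|_ [w /= /(nthP 0)[j jG <-] <-]].
    by exists G`_j; rewrite //= mem_nth.
  by exists (Ordinal jG).
(* It remains to identify the hull of the lattice points with that of the candidates in [F']. *)
rewrite -vertG; congr vertices; set S := _ `&` _.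
apply/seteqP; split; apply: convex_hull_mono; last first.
  move=> _ [w /= + <-]; rewrite mem_filter => /andP[/andP[/asboolP wr wP] wF].
  apply: sub_convex_hull; split; first by rewrite PE; exact: (inPt w wF).1.
  exact: Hd wr.
have Sfin : finite_set S.
  apply: (lattice_box_finite _ (t ^ D)%N) => [x []//|x j [xP _]].
  by rewrite natrX; exact: PD.
(* A half-space containing the hull of [F'] contains the midpoint-extreme points of [S], all of
   which come from [F'], and therefore all of the finite set [S]. *)
move=> x Sx; rewrite hullF' => a sa.
apply: (midpoint_extreme_minimizes _ _ Sfin) Sx => {}x xext.
suff : polyhedron s' t x by apply.
rewrite -hullF'; apply: sub_convex_hull.
have [w wF xw] := cand x xext; exists w => //=.
have [[xP xL] _] := xext.
rewrite mem_filter wF andbT; apply/andP; split.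
  by apply/asboolP; apply: Hd wF _ _ tr _; rewrite -xw.
apply: contrapT => /negP nw; apply: (inPt w wF).2 nw _.
by rewrite -xw -PE.
Unshelve. all: by end_near. Qed.
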